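(* Let $K\subseteq\mathbb{R}^n$ be compact and let $T:K\to\mathbb{R}^n$ be a $1$-Lipschitz map (Euclidean norm). (i) Suppose that $\mathcal{U}(\mu*\gamma_s)\le\mathcal{U}(T_\#\mu*\gamma_s)$ for every $\mu\in\mathcal{P}(K)$, every $s>0$, and every internal energy $\mathcal{U}$ in $\mathcal{PC}_1$ (nondecreasing pressure). Then $|T[K]+r\mathcal{B}|\le|K+r\mathcal{B}|$ for every $r>0$. (ii) Suppose that $\mathcal{U}(\mu*\gamma_s)\le\mathcal{U}(T_\#\mu*\gamma_s)$ for every $\mu\in\mathcal{P}(K)$, every $s>0$, and every internal energy $\mathcal{U}$ in $\mathcal{PC}_0$ (nonnegative pressure). Then $$\big|(T[K]+r_2\mathcal{B})\setminus(T[K]+r_1\mathcal{B})\big|\le\big|(K+r_2\mathcal{B})\setminus(K+r_1\mathcal{B})\big|$$ for every $0<r_1<r_2$.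
   Context: $\mathcal{B}$ is the closed Euclidean unit ball centred at $0$ in $\mathbb{R}^n$, $|\cdot|$ is Lebesgue measure, and $A+r\mathcal{B}$ is the Minkowski sum. $\mathcal{P}(K)$ is the set of Borel probability measures on $K$. $\gamma_s(x)=(2\pi s)^{-n/2}e^{-\|x\|_2^2/(2s)}$; $\mu*\gamma_s$ denotes the density $x\mapsto\int\gamma_s(x-y)\,d\mu(y)$ on $\mathbb{R}^n$; $T_\#\mu$ is the push-forward. An energy density is a measurable $U:[0,\infty)\to\mathbb{R}$ with $U(0)=0$; its internal energy is $\mathcal{U}(\rho)=\int_{\mathbb{R}^n}U(\rho(x))\,dx\in[-\infty,+\infty]$ for probability densities $\rho$ for which the integral is defined. $\mathcal{U}$ is in $\mathcal{PC}_1$ (nondecreasing pressure) if $U$ is convex on $[0,\infty)$; $\mathcal{U}$ is in $\mathcal{PC}_0$ (nonnegative pressure) if $\rho\mapsto U(\rho)/\rho$ is nondecreasing on $(0,\infty)$. *)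

(* Defs.v *)
From HB Require Import structures.
From mathcomp Require Import all_boot all_order all_algebra.
From mathcomp Require Import all_classical all_reals all_analysis.
From mathcomp Require Import measurable_realfun.

Set Implicit Arguments.
Unset Strict Implicit.
Unset Printing Implicit Defensive.

Import Order.TTheory GRing.Theory Num.Theory.
Import numFieldNormedType.Exports.

Local Open Scope classical_set_scope.
Local Open Scope ring_scope.

(* R^n is 'rV[R]_n. The library norm and balls on 'rV[R]_n are those of the sup
   norm; they induce the Euclidean topology, so [open] and [compact] are the
   usual notions, but every metric notion below goes through [enorm]. *)
Notation borel_rV R n := (g_sigma_algebraType (@open 'rV[R]_n)).

Definition rV_cons (R : realType) n (p : R * borel_rV R n) :
    borel_rV R (1 + n) :=
  row_mx (p.1)%:M (p.2 : 'rV[R]_n).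

Definition rV_uncons (R : realType) n (x : borel_rV R (1 + n)) :
    R * borel_rV R n :=
  ((x : 'rV[R]_(1 + n)) ord0 ord0, rsubmx (x : 'rV[R]_(1 + n))).

(* Lebesgue measure on the Borel sets of R^n, as an iterated product; it is
   characterized by its values on boxes, see [lebesgue_rV_box]. *)
Fixpoint lebesgue_rV (R : realType) (n : nat) : set (borel_rV R n) -> \bar R :=
  match n with
  | 0 => dirac (0 : borel_rV R 0)
  | n'.+1 => pushforward (lebesgue_measure \x @lebesgue_rV R n')%E
               (@rV_cons R n')
  end.
Arguments lebesgue_rV {R} n _.

Section borel_rV_theory.
Variable R : realType.

Lemma measurable_coord_rV n (i : 'I_n) :
  measurable_fun [set: borel_rV R n] (fun x : borel_rV R n => x ord0 i : R).
Proof.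
apply: (measurability _ (RGenOInfty.measurableE R)) => _ [_ [x ->] <-].
rewrite setTI; apply: sub_sigma_algebra.
by apply: open_comp => // M _; exact: coord_continuous.
Qed.

Lemma measurable_fun_rV d (T : measurableType d) n (f : T -> 'rV[R]_n) :
  (forall i, measurable_fun [set: T] (fun x => f x ord0 i)) ->
  measurable_fun [set: T] (f : T -> borel_rV R n).
Proof.
move=> mf; apply: (measurability (@open 'rV[R]_n : set (set (borel_rV R n)))) => //.
move=> _ [B oB <-]; rewrite setTI.
pose F (q : 'rV[rat]_n * nat) : set 'rV[R]_n :=
  let b := ball (map_mx ratr q.1 : 'rV[R]_n) (q.2.+1%:R^-1 : R) in
  if asbool (b `<=` B) then b else set0.
have -> : B = \bigcup_q F q.
  apply/seteqP; split => [v Bv|v [q _]]; last first.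
    by rewrite /F; case: asboolP => // h; exact: h.
  have /nbhs_ballP [e /= e0 eB] : nbhs v B by rewrite openE in oB; exact: oB.
  have [k ke] : exists k : nat, k.+1%:R^-1 < e / 2.
    have e20 : 0 < e / 2 by rewrite divr_gt0.
    exists (Num.truncn (e / 2)^-1).
    rewrite invf_plt ?posrE//; exact: truncnS_gt.
  have k0 : 0 < k.+1%:R^-1 :> R by rewrite invr_gt0.
  have hq i : exists q : rat, `|ratr q - v ord0 i| < k.+1%:R^-1.
    have : v ord0 i - k.+1%:R^-1 < v ord0 i + k.+1%:R^-1.
      by rewrite ltrBlDr -addrA ltrDl addr_gt0.
    move=> /rat_in_itvoo [q]; rewrite in_itv/= => /andP[q1 q2]; exists q.
    by rewrite ltr_norml ltrBrDl q1 ltrBlDl.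
  exists (\row_i sval (cid (hq i)), k) => //.
  rewrite /F /=; case: asboolP => [_|].
    by split => // i j; rewrite !mxE (ord1 i) /ball/=; case: cid.
  case=> w [_ hw]; apply: eB; split => // i j; rewrite ord1 /ball/=.
  have /= := hw ord0 j; rewrite !mxE/= /ball/=; case: cid => /= q hq1 hq2.
  rewrite -(subrKA (ratr q)) (le_lt_trans (ler_normD _ _))// (splitr e).
  by rewrite ltrD// ?(lt_trans hq2)// distrC (lt_trans hq1).
rewrite preimage_bigcup; apply: countable_bigcupT_measurable => // q.
rewrite /F; case: asboolP => _; last by rewrite preimage_set0.
have -> : f @^-1` ball (map_mx ratr q.1 : 'rV[R]_n) (q.2.+1%:R^-1 : R) =
  \bigcap_(i in [set: 'I_n])
    (fun x => f x ord0 i) @^-1` ball (ratr (q.1 ord0 i) : R) q.2.+1%:R^-1.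
  apply/seteqP; split => [x [_ hx] i _|x hx].
    by have := hx ord0 i; rewrite mxE.
  by split; [rewrite invr_gt0|move=> i j; rewrite mxE ord1; exact: hx].
apply: fin_bigcap_measurable => // i _.
rewrite -[X in measurable X]setTI; apply: mf => //; exact: measurable_ball.
Qed.

Lemma measurable_rV_cons n :
  measurable_fun [set: R * borel_rV R n]
    (@rV_cons R n).
Proof.
apply: measurable_fun_rV => i; rewrite /rV_cons.
case: (split_ordP i) => j ->.
  under eq_fun do rewrite row_mxEl mxE (ord1 j) mulr1n.
  exact: measurable_fst.
under eq_fun do rewrite row_mxEr.
apply: (measurableT_comp (measurable_coord_rV j)); exact: measurable_snd.
Qed.

Lemma measurable_rV_uncons n :
  measurable_fun [set: borel_rV R (1 + n)]
    (@rV_uncons R n).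
Proof.
apply/measurable_fun_pairP; split; first exact: measurable_coord_rV.
apply: measurable_fun_rV => i /=.
rewrite (_ : (fun x => _) = (fun x : 'rV[R]_(1 + n) => x ord0 (rshift 1 i))).
  exact: measurable_coord_rV.
by apply/funext => x; rewrite /= mxE.
Qed.

Lemma rV_cons0 n (p : R * borel_rV R n) :
  (rV_cons p : 'rV[R]_n.+1) ord0 ord0 = p.1.
Proof.
rewrite /rV_cons (_ : (ord0 : 'I_n.+1) = lshift n (ord0 : 'I_1)).
  by rewrite [LHS](row_mxEl _ _ ord0 ord0) mxE mulr1n.
exact: val_inj.
Qed.

Lemma rV_consS n (p : R * borel_rV R n) (i : 'I_n) :
  (rV_cons p : 'rV[R]_n.+1) ord0 (lift ord0 i) = p.2 ord0 i.
Proof.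
rewrite /rV_cons (_ : (lift ord0 i : 'I_n.+1) = rshift 1 i).
  by rewrite [LHS](row_mxEr _ _ ord0 i).
exact: val_inj.
Qed.

Lemma rV_consK n : cancel (@rV_cons R n) (@rV_uncons R n).
Proof.
move=> [a v]; rewrite /rV_uncons /rV_cons row_mxKr; congr pair.
have -> : (ord0 : 'I_(1 + n)) = lshift n ord0 by exact: val_inj.
by rewrite row_mxEl mxE eqxx mulr1n.
Qed.

Section lebesgue_rV_step.
Variables (n : nat) (m : {sigma_finite_measure set (borel_rV R n) -> \bar R}).

Let nu : set (borel_rV R (1 + n)) -> \bar R :=
  pushforward (lebesgue_measure \x m)%E (@rV_cons R n).

Let nu0 : nu set0 = 0%E.
Proof. by rewrite /nu /pushforward preimage_set0 measure0. Qed.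

Let nu_ge0 A : (0 <= nu A)%E.
Proof. exact: integral_ge0. Qed.

Let nu_sigma_additive : semi_sigma_additive nu.
Proof.
move=> F mF tF mUF; rewrite /nu /pushforward preimage_bigcup.
have mpre A : measurable A -> measurable (@rV_cons R n @^-1` A : set (R * borel_rV R n)%type).
  by move=> mA; rewrite -[X in measurable X]setTI; exact: measurable_rV_cons.
apply: measure_semi_sigma_additive.
- by move=> k; exact: mpre.
- apply/trivIsetP => /= i j _ _ ij; rewrite -preimage_setI.
  by move/trivIsetP : tF => /(_ _ _ _ _ ij) ->//; rewrite preimage_set0.
- by rewrite -preimage_bigcup; exact: mpre.
Qed.

HB.instance Definition _ := isMeasure.Build _ _ _ nu nu0 nu_ge0 nu_sigma_additive.

Let nu_sigma_finite : sigma_finite setT nu.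
Proof.
have /sigma_finiteP[F [TF ndF Foo]] := sigma_finiteT (@lebesgue_measure R).
have /sigma_finiteP[G [TG ndG Goo]] := sigma_finiteT m.
exists (fun k => @rV_uncons R n @^-1` (F k `*` G k)).
  apply/esym; rewrite -subTset => x _.
  have [i _ Fi] : (\bigcup_k F k) (rV_uncons x).1 by rewrite -TF.
  have [j _ Gj] : (\bigcup_k G k) (rV_uncons x).2 by rewrite -TG.
  exists (maxn i j) => //; split.
  - by move: Fi; exact/subsetPset/ndF/leq_maxl.
  - by move: Gj; exact/subsetPset/ndG/leq_maxr.
move=> k; have [mF Fk] := Foo k; have [mG Gk] := Goo k; split.
  rewrite -[X in measurable X]setTI; apply: measurable_rV_uncons => //.
  exact: measurableX.
rewrite /nu /pushforward -comp_preimage.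
rewrite (_ : _ \o _ = id) ?preimage_id; last first.
  by apply/funext => p /=; rewrite rV_consK.
by rewrite product_measure1E// lte_mul_pinfty// ge0_fin_numE.
Qed.

HB.instance Definition _ := Measure_isSigmaFinite.Build _ _ _ nu nu_sigma_finite.

Lemma lebesgue_rV_step :
  exists m' : {sigma_finite_measure set (borel_rV R (1 + n)) -> \bar R},
    (m' : set _ -> \bar R) = nu.
Proof. by exists nu. Qed.

End lebesgue_rV_step.

Lemma lebesgue_rV_ex n :
  exists m : {sigma_finite_measure set (borel_rV R n) -> \bar R},
    (m : set _ -> \bar R) = lebesgue_rV n.
Proof.
elim: n => [|n [m mE]]; first by exists (dirac (0 : borel_rV R 0)).
by have [m' m'E] := lebesgue_rV_step m; exists m'; rewrite m'E mE.
Qed.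

Let leb0 n : lebesgue_rV n set0 = 0%E :> \bar R.
Proof. by have [m <-] := lebesgue_rV_ex n; exact: measure0. Qed.

Let leb_ge0 n A : (0 <= lebesgue_rV n A :> \bar R)%E.
Proof. by have [m <-] := lebesgue_rV_ex n; exact: measure_ge0. Qed.

Let leb_sigma_additive n :
  semi_sigma_additive (lebesgue_rV n : set (borel_rV R n) -> \bar R).
Proof. by have [m <-] := lebesgue_rV_ex n; exact: measure_semi_sigma_additive. Qed.

HB.instance Definition _ n := isMeasure.Build _ _ _
  (lebesgue_rV n : set (borel_rV R n) -> \bar R)
  (leb0 n) (@leb_ge0 n) (@leb_sigma_additive n).

Let leb_sigma_finite n :
  sigma_finite setT (lebesgue_rV n : set (borel_rV R n) -> \bar R).
Proof. by have [m <-] := lebesgue_rV_ex n; exact: sigma_finiteT. Qed.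

HB.instance Definition _ n := Measure_isSigmaFinite.Build _ _ _
  (lebesgue_rV n : set (borel_rV R n) -> \bar R) (@leb_sigma_finite n).

Lemma lebesgue_rV_box n (A : 'I_n -> set R) : (forall i, measurable (A i)) ->
  lebesgue_rV n [set x | forall i, A i (x ord0 i)] =
  (\prod_(i < n) lebesgue_measure (A i))%E.
Proof.
elim: n A => [|n IH] A mA.
  rewrite big_ord0 /= diracE mem_set//; by case.
pose B : set (borel_rV R n) := [set x | forall i, A (lift ord0 i) (x ord0 i)].
have mB : measurable B.
  have -> : B = \bigcap_(i in [set: 'I_n])
      ((fun x : borel_rV R n => x ord0 i) @^-1` A (lift ord0 i)).
    by apply/seteqP; split => [x hx i _|x hx i]; exact: hx.
  apply: fin_bigcap_measurable => // i _.
  by rewrite -[X in measurable X]setTI; exact: measurable_coord_rV.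
rewrite big_ord_recl -(IH (fun i => A (lift ord0 i)))//.
have E : (lebesgue_measure \x lebesgue_rV n)%E (A ord0 `*` B) =
    (lebesgue_measure (A ord0) * lebesgue_rV n B)%E.
  by rewrite product_measure1E; [|exact: (mA ord0)|exact: mB].
rewrite -[RHS]E [LHS]/= /pushforward; congr (_ _).
apply/seteqP; split => [[a v] h|[a v] [h1 h2] i].
  split => [|i] /=; first by have := h ord0; rewrite /= rV_cons0.
  by have := h (lift ord0 i); rewrite /= rV_consS.
rewrite /=; case: (unliftP ord0 i) => [j ->|->]; last by rewrite rV_cons0.
by rewrite rV_consS; exact: h2.
Qed.

End borel_rV_theory.

Section definitions.
Variables (R : realType) (n : nat).
Implicit Types (A K : set 'rV[R]_n) (x y : 'rV[R]_n) (r s : R).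
Implicit Types (U : R -> R) (rho : 'rV[R]_n -> R).

Definition enorm x : R := Num.sqrt (\sum_(i < n) x ord0 i ^+ 2).

Definition eunit_ball : set 'rV[R]_n := [set x | enorm x <= 1].

Definition minkowski_sum A B : set 'rV[R]_n := [set a + b | a in A & b in B].

Definition thicken A r : set 'rV[R]_n :=
  minkowski_sum A [set r *: b | b in eunit_ball].

Definition gauss s x : R :=
  (2 * pi * s) `^ (- (n%:R / 2)) * expR (- (enorm x ^+ 2) / (2 * s)).

Definition gauss_conv (mu : set (borel_rV R n) -> \bar R) s x : R :=
  fine (\int[mu]_y (gauss s (x - y))%:E)%E.

(* A measure concentrated on K is pushed forward by the restriction of T to K,
   so that the values of T outside of K, where T need not even be measurable,
   are irrelevant. *)
Definition pushforward_on K (T : 'rV[R]_n -> 'rV[R]_n)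
    (mu : set (borel_rV R n) -> \bar R) : set (borel_rV R n) -> \bar R :=
  pushforward (fun A : set (borel_rV R n) => mu (K `&` A))
    (T : borel_rV R n -> borel_rV R n).

(* An energy density on [0, +oo[ is a total function whose values on
   ]-oo, 0[ are irrelevant. *)
Definition energy_density U : Prop :=
  measurable_fun (`[0, +oo[%classic : set R) U /\ U 0 = 0.

Definition internal_energy U rho : \bar R :=
  (\int[lebesgue_rV n]_x (U (rho x))%:E)%E.

(* The library integral is total and may be a junk value +oo - +oo; the
   integral is meaningful when the positive or the negative part has a finite
   integral. *)
Definition internal_energy_defined U rho : Prop :=
  let f := fun x : borel_rV R n => (U (rho x))%:E in
  measurable_fun [set: borel_rV R n] f /\
  ((\int[lebesgue_rV n]_x f^\+ x < +oo)%E \/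
   (\int[lebesgue_rV n]_x f^\- x < +oo)%E).

Definition nondecreasing_pressure U : Prop :=
  energy_density U /\ convex_function (`[0, +oo[%classic : set R^o) U.

Definition nonnegative_pressure U : Prop :=
  energy_density U /\ {in `]0, +oo[ &, {homo (fun t => U t / t) : t u / t <= u}}.

(* Probability measures on K are Borel probability measures on R^n giving mass
   1 to K. *)
Definition energies_le (PC : (R -> R) -> Prop) K (T : 'rV[R]_n -> 'rV[R]_n) :
    Prop :=
  forall mu : probability (borel_rV R n) R, mu K = 1%E ->
  forall s, 0 < s -> forall U, PC U ->
  let rho := gauss_conv mu s in
  let rhoT := gauss_conv (pushforward_on K T mu) s in
  internal_energy_defined U rho -> internal_energy_defined U rhoT ->
  (internal_energy U rho <= internal_energy U rhoT)%E.

End definitions.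
Arguments eunit_ball {R n}.

(* Main.v *)
Require Import Defs.
From HB Require Import structures.
From mathcomp Require Import all_boot all_order all_algebra finmap.
From mathcomp Require Import all_classical all_reals all_analysis.
From mathcomp Require Import measurable_realfun lra ring.
Import Order.TTheory GRing.Theory Num.Theory.
Import numFieldNormedType.Exports.
Local Open Scope classical_set_scope.
Local Open Scope ring_scope.

Set Implicit Arguments.
Unset Strict Implicit.
Unset Printing Implicit Defensive.

(* Let [mu] be the uniform measure on a finite [e]-net of [K]. As [s -> 0],
   [mu * gamma_s] is [exp (- d^2 / (2 s))] up to factors negligible on the
   exponential scale, where [d] is the distance to the net. The energy density
   [U(t) = - min(t / a, 1)], cut off to [0] for [t > b], has nonnegative
   pressure, and for [a], [b] of order [exp (- r2^2 / (2 s))],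
   [exp (- r1^2 / (2 s))] its energy tends to minus the volume of
   [r1 < d < r2]. Since [T] is 1-Lipschitz, it maps the net to an [e]-net of
   [T[K]], so the hypothesis compares the two shells up to [O(e)], and [e -> 0]
   concludes. Without the cutoff [U] is convex, and the same argument compares
   the full neighbourhoods; this is the case [r1 < 0], where the cutoff is
   inactive and the inner neighbourhood is empty. *)

(** * The Euclidean norm on row vectors *)

Section enorm_theory.
Context {R : realType} {n : nat}.
Implicit Types (x y : 'rV[R]_n).

Lemma enorm_ge0 x : 0 <= enorm x.
Proof. exact: sqrtr_ge0. Qed.

Lemma enorm_sqr x : enorm x ^+ 2 = \sum_(i < n) x ord0 i ^+ 2.
Proof. by rewrite sqr_sqrtr// sumr_ge0// => i _; exact: sqr_ge0. Qed.

Lemma enormZ (a : R) x : enorm (a *: x) = `|a| * enorm x.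
Proof.
rewrite /enorm -sqrtr_sqr -sqrtrM ?sqr_ge0// mulr_sumr.
by congr (Num.sqrt _); apply: eq_bigr => i _; rewrite mxE exprMn.
Qed.

Lemma enormN x : enorm (- x) = enorm x.
Proof. by rewrite -scaleN1r enormZ normrN1 mul1r. Qed.

Lemma enormB x y : enorm (x - y) = enorm (y - x).
Proof. by rewrite -enormN opprB. Qed.

Lemma ler_coord_enorm x i : `|x ord0 i| <= enorm x.
Proof.
rewrite -sqrtr_sqr ler_wsqrtr// (bigD1 i)//= lerDl sumr_ge0// => j _.
exact: sqr_ge0.
Qed.

Lemma enorm0_eq0 x : enorm x = 0 -> x = 0.
Proof.
move=> x0; apply/rowP => i; rewrite mxE.
by apply/normr0_eq0/le_anti; rewrite normr_ge0 -x0 ler_coord_enorm.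
Qed.

(** Cauchy-Schwarz: the squared norm of [enorm y *: x - enorm x *: y] is nonnegative and contains
    [2 * (enorm x * enorm y)] as a factor, which is divided out once neither norm vanishes. *)
Lemma dot_le_enorm x y : \sum_(i < n) x ord0 i * y ord0 i <= enorm x * enorm y.
Proof.
have [x0|x0] := eqVneq (enorm x) 0.
  rewrite x0 mul0r (enorm0_eq0 x0) big1// => i _; by rewrite mxE mul0r.
have [y0|y0] := eqVneq (enorm y) 0.
  rewrite y0 mulr0 (enorm0_eq0 y0) big1// => i _; by rewrite mxE mulr0.
have xy_gt0 : 0 < enorm x * enorm y by rewrite mulr_gt0// lt0r enorm_ge0 ?x0 ?y0.
have : 0 <= enorm (enorm y *: x - enorm x *: y) ^+ 2 by exact: sqr_ge0.
rewrite enorm_sqr.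
have -> : \sum_(i < n) (enorm y *: x - enorm x *: y) ord0 i ^+ 2 =
    2 * (enorm x * enorm y) *
    (enorm x * enorm y - \sum_(i < n) x ord0 i * y ord0 i).
  under eq_bigr => i _.
    rewrite !mxE (_ : _ ^+ 2 = enorm y ^+ 2 * (x ord0 i ^+ 2) +
      enorm x ^+ 2 * y ord0 i ^+ 2 -
      2 * (enorm x * enorm y) * (x ord0 i * y ord0 i)); last by ring.
    over.
  rewrite sumrB big_split/= -!mulr_sumr -!enorm_sqr; ring.
by rewrite pmulr_rge0 ?subr_ge0// mulr_gt0.
Qed.

Lemma ler_enormD x y : enorm (x + y) <= enorm x + enorm y.
Proof.
rewrite -(@ler_pXn2r _ 2)// ?nnegrE ?addr_ge0 ?enorm_ge0// enorm_sqr.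
under eq_bigr => i _.
  rewrite !mxE (_ : _ ^+ 2 = x ord0 i ^+ 2 + y ord0 i ^+ 2 +
    2 * (x ord0 i * y ord0 i)); last by ring.
  over.
rewrite !big_split/= -mulr_sumr -!enorm_sqr; have := dot_le_enorm x y; lra.
Qed.

Lemma ler_enormBD x y (z : 'rV[R]_n) : enorm (x - z) <= enorm (x - y) + enorm (y - z).
Proof. by rewrite -(subrKA y) ler_enormD. Qed.

Lemma enorm_le_norm x : enorm x <= Num.sqrt n%:R * `|x|.
Proof.
have -> : `|x| = Num.sqrt (`|x| ^+ 2) by rewrite sqrtr_sqr ger0_norm.
rewrite -sqrtrM//.
rewrite ler_wsqrtr// -[n in n%:R]card_ord -sum1_card natr_sum mulr_suml.
apply: ler_sum => i _; rewrite mul1r -[leLHS]real_normK ?num_real// ler_pXn2r ?nnegrE//.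
rewrite [leRHS]mx_normrE; exact: (le_bigmax _ (fun ij => `|x ij.1 ij.2|) (ord0, i)).
Qed.

(** This is [(a + b)^2 <= 2 a^2 + 2 b^2] after the triangle inequality. It serves to dominate a
    Gaussian centred at [y] by one centred at the origin. *)
Lemma enorm_half_sqr x y : enorm x ^+ 2 <= 2 * enorm (x - y) ^+ 2 + 2 * enorm y ^+ 2.
Proof.
have h : enorm x <= enorm (x - y) + enorm y.
  by have := ler_enormD (x - y) y; rewrite subrK.
have := enorm_ge0 x; have := enorm_ge0 y; have := enorm_ge0 (x - y).
have := sqr_ge0 (enorm (x - y) - enorm y).
have := h; nra.
Qed.

Lemma measurable_enorm : measurable_fun [set: borel_rV R n] (@enorm R n).
Proof.
apply: measurableT_comp; first exact: continuous_measurable_fun (@sqrt_continuous R).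
apply: measurable_sum => i; apply: measurable_funX; exact: measurable_coord_rV.
Qed.

Lemma measurable_expR_enorm : measurable_fun [set: borel_rV R n]
  (fun x : borel_rV R n => (expR (- enorm x ^+ 2))%:E).
Proof.
apply/measurable_EFinP; apply: (measurableT_comp (@measurable_expR R)).
by apply: measurable_funN; apply: measurable_funX; exact: measurable_enorm.
Qed.

End enorm_theory.

(** * Iterated integration and finiteness of the Gaussian integral *)

Lemma lebesgue_rVS (R : realType) n (f : borel_rV R n.+1 -> \bar R) :
  measurable_fun setT f -> (forall x, 0 <= f x)%E ->
  (\int[lebesgue_rV n.+1]_x f x =
   \int[lebesgue_measure]_a \int[lebesgue_rV n]_v f (@rV_cons R n (a, v)))%E.
Proof.
move=> mf f0.
(* [X] is the real line with the sigma-algebra generated by half-open intervals, the type on which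
   [lebesgue_measure] is defined. *)
pose X := g_sigma_algebraType (R.-ocitv.-measurable).
have mc : measurable_fun [set: X * borel_rV R n] (@rV_cons R n : X * borel_rV R n -> _).
  exact: measurable_rV_cons.
rewrite -(fubini_tonelli1 (f \o (@rV_cons R n : X * borel_rV R n -> _))); last 2 first.
- exact: measurableT_comp mf mc.
- by move=> x; exact: f0.
exact: (ge0_integral_pushforward mc (lebesgue_measure \x lebesgue_rV n)%E measurableT mf).
Qed.

Lemma enorm_rV_cons (R : realType) n (p : R * borel_rV R n) :
  enorm (@rV_cons R n p) ^+ 2 = p.1 ^+ 2 + enorm (p.2 : 'rV[R]_n) ^+ 2.
Proof.
rewrite !enorm_sqr big_ord_recl rV_cons0; congr (_ + _).
by apply: eq_bigr => i _; rewrite rV_consS.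
Qed.

(** Induction on the dimension: the squared norm is additive along [rV_cons], so by Tonelli the
    integral splits off a one-dimensional Gaussian factor. *)
Lemma gauss_integral_rV (R : realType) n :
  exists2 I : R, 0 <= I &
    (\int[lebesgue_rV n]_x (expR (- enorm x ^+ 2))%:E = I%:E)%E.
Proof.
have mE := @measurable_expR_enorm R.
elim: n => [|n [I I0 IH]].
  exists 1 => //.
  have /= -> := integral_dirac (0 : borel_rV R 0) measurableT (mE 0%N).
  rewrite diracT mul1e enorm_sqr big_ord0 oppr0 expR0//.
have [J J0 JE] : exists2 J : R, 0 <= J &
    (\int[lebesgue_measure]_a (gauss_fun a)%:E = J%:E)%E.
  exists (fine (\int[lebesgue_measure]_a (gauss_fun a)%:E)%E).
    by apply/fine_ge0/integral_ge0 => a _; rewrite lee_fin gauss_fun_ge0.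
  rewrite fineK//; apply: integrable_fin_num => //; exact: integrableT_gauss.
exists (J * I); first exact: mulr_ge0.
rewrite lebesgue_rVS; [|exact: mE|by move=> x; rewrite lee_fin expR_ge0].
have inner a : (\int[lebesgue_rV n]_v (expR (- enorm (@rV_cons R n (a, v)) ^+ 2))%:E
    = (gauss_fun a)%:E * I%:E)%E.
  rewrite -IH -ge0_integralZl//; last by rewrite lee_fin gauss_fun_ge0.
  by apply: eq_integral => v _; rewrite enorm_rV_cons opprD expRD EFinM.
under eq_integral do rewrite inner.
rewrite ge0_integralZr//.
- by rewrite EFinM -JE.
- by apply/measurable_EFinP; exact: measurable_gauss_fun.
- by move=> v _; rewrite lee_fin expR_ge0.
Qed.

(** * Closed neighbourhoods of compact sets, finite nets and volumes *)

Section near.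
Context {R : realType} {n : nat}.
Implicit Types (A K : set 'rV[R]_n) (x y : 'rV[R]_n) (r s : R).

(** Agrees with [thicken] for positive radii but is empty for negative ones, where [thicken] depends
    on the absolute value of [r]. A full neighbourhood is thus a difference of two [near_set]s whose
    inner radius is negative. *)
Definition near_set A r : set 'rV[R]_n :=
  [set x | exists2 p, A p & enorm (x - p) <= r].

Lemma thickenE A r : 0 < r -> thicken A r = near_set A r.
Proof.
move=> r0; apply/seteqP; split=> [_ [p Ap [_ [b b1 <-] <-]]|x [p Ap xp]].
  exists p => //; rewrite addrC addKr enormZ gtr0_norm//.
  by rewrite -[leRHS]mulr1 ler_wpM2l// ltW.
exists p => //; exists (x - p); last by rewrite addrC subrK.
exists (r^-1 *: (x - p)); last by rewrite scalerA divff ?scale1r ?gt_eqF.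
by rewrite /eunit_ball/= enormZ gtr0_norm ?invr_gt0// ler_pdivrMl// mulr1.
Qed.

Lemma near_set_le A r s : r <= s -> near_set A r `<=` near_set A s.
Proof. by move=> rs x [p Ap xp]; exists p => //; exact: le_trans rs. Qed.

Lemma near_set_lt0 A r : r < 0 -> near_set A r = set0.
Proof.
move=> r0; apply/seteqP; split=> // x [p _]; apply/negP; rewrite -ltNge.
exact: lt_le_trans (enorm_ge0 _).
Qed.

Lemma norm_le_enorm x : `|x| <= enorm x.
Proof.
rewrite [leLHS]mx_normrE; apply: bigmax_le => [|[i j] _]; first exact: enorm_ge0.
by rewrite ord1 ler_coord_enorm.
Qed.

Lemma near_enorm x e : 0 < e -> \forall y \near x, enorm (x - y) <= e.
Proof.
(* The summand [1] keeps [c] positive in dimension 0. *)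
move=> e0; pose c := Num.sqrt n%:R + 1 : R.
have c0 : 0 < c by rewrite ltr_wpDl// sqrtr_ge0.
have ec0 : 0 < e / c by rewrite divr_gt0.
near=> y; apply: le_trans (enorm_le_norm _) _.
have xy : `|x - y| <= e / c.
  by near: y; apply: (@cvgr_dist_le _ _ _ (nbhs x) _ id x) => //; exact: cvg_id.
apply: (@le_trans _ _ (c * (e / c))); last by rewrite mulrC divfK ?gt_eqF.
by apply: ler_pM => //; rewrite ?sqrtr_ge0// lerDl.
Unshelve. all: by end_near. Qed.

Lemma compact_image_lipschitz K (T : 'rV[R]_n -> 'rV[R]_n) :
  compact K ->
  (forall x y, K x -> K y -> enorm (T x - T y) <= enorm (x - y)) ->
  compact (T @` K).
Proof.
move=> cK TL; apply: continuous_compact => //.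
apply/subspace_continuousP => x Kx; apply/cvgrPdist_le => e e0.
have := near_enorm x e0; apply: filterS => y xy Ky.
exact: le_trans (norm_le_enorm _) (le_trans (TL _ _ Kx Ky) xy).
Qed.

(** The distance from [x] to a nonempty compact [K] is attained, hence exceeds [r]; half of the gap
    is a valid [e]. This gives both the closedness of [near_set K r] and its continuity in the
    radius. *)
Lemma compact_near_set K x r : compact K -> ~ near_set K r x ->
  exists2 e, 0 < e & ~ near_set K (r + e) x.
Proof.
move=> cK xr; have [[p Kp]|K0] := pselect (K !=set0); last first.
  by exists 1 => // -[p Kp _]; apply: K0; exists p.
have [||c] := @compact_EVT_min 'rV[R]_n R (fun p : 'rV[R]_n => enorm (x - p)) K _ cK.
- by exists p.
- apply: continuous_subspaceT => y; apply/(@cvgrPdist_le _ _ _ (nbhs y)) => e e0.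
  have := near_enorm y e0; apply: filterS => z yz.
  have := ler_enormBD x y z; have := ler_enormBD x z y.
  rewrite (enormB z y); rewrite ler_norml; move: yz; lra.
rewrite inE => Kc cmin; exists ((enorm (x - c) - r) / 2).
  by rewrite divr_gt0// subr_gt0 ltNge; apply/negP => xc; apply: xr; exists c.
move=> [q Kq xq]; have := cmin q; rewrite inE => /(_ Kq) cq.
have : r < enorm (x - c) by rewrite ltNge; apply/negP => xc; apply: xr; exists c.
lra.
Qed.

Lemma measurable_near_set K r : compact K ->
  measurable (near_set K r : set (borel_rV R n)).
Proof.
move=> cK; rewrite -[near_set K r]setCK; apply: measurableC.
apply: sub_sigma_algebra => /=; rewrite openE => x /= /(compact_near_set cK)[e e0 xe].
have := near_enorm x e0; apply: filterS => y xy [p Kp yp]; apply: xe.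
by exists p => //; have := ler_enormBD x y p; lra.
Qed.

Lemma compact_enorm_bounded K : compact K -> exists M, forall p, K p -> enorm p <= M.
Proof.
move=> /compact_bounded[M [_ /(_ (M + 1))]]; rewrite ltrDl ltr01 => /(_ isT) KM.
exists (Num.sqrt n%:R * (M + 1)) => p Kp; apply: le_trans (enorm_le_norm _) _.
by rewrite ler_wpM2l ?sqrtr_ge0//; exact: KM.
Qed.

Lemma compact_net K e : compact K -> K !=set0 -> 0 < e ->
  exists N (x : nat -> 'rV[R]_n), (forall i, K (x i)) /\
    forall p, K p -> exists2 i, (i < N.+1)%N & enorm (p - x i) <= e.
Proof.
move=> cK [p0 Kp0] e0.
move: (cK); rewrite compact_cover => cK'.
have [||D DK KD] := cK' _ K (fun p => [set x | enorm (p - x) <= e]^°).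
- by move=> p _; exact: open_interior.
- by move=> p Kp; exists p => //; exact: near_enorm.
(* The sequence enumerates [D] and continues with the default [p0], so every term lies in [K] and
   there is at least one point. *)
exists #|` D|, (nth p0 D); split=> [i|p /KD[q /= qD /interior_subset/= qp]].
  have [iD|iD] := ltnP i #|` D|; last by rewrite nth_default.
  by have /DK := mem_nth p0 iD; rewrite inE.
exists (index q D); last by rewrite nth_index// enormB.
by rewrite ltnS index_size.
Qed.

(** On [A] the indicator is at most [expR (M ^+ 2) * expR (- enorm x ^+ 2)], whose integral is
    finite. *)
Lemma lebesgue_bounded_fin (A : set 'rV[R]_n) M :
  measurable (A : set (borel_rV R n)) -> (forall x, A x -> enorm x <= M) ->
  (lebesgue_rV n A < +oo)%E.
Proof.
move=> mA AM; have [I I0 IE] := gauss_integral_rV R n.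
have mg := @measurable_expR_enorm R n.
apply: (@le_lt_trans _ _ ((expR (M ^+ 2))%:E * I%:E)%E); last first.
  by rewrite -EFinM ltry.
rewrite -IE -ge0_integralZl//.
rewrite -[in leLHS](setIT A) -integral_indic//.
apply: ge0_le_integral => //.
- by apply/measurable_EFinP; exact: measurable_indic.
- exact: measurable_funeM.
move=> x _; rewrite -EFinM lee_fin indicE -expRD.
have [|_] := boolP (x \in A); last by rewrite expR_ge0.
rewrite inE => /AM xM; rewrite -expR0 ler_expR subr_ge0.
by rewrite ler_sqr ?nnegrE ?enorm_ge0// (le_trans _ xM) ?enorm_ge0.
Qed.

End near.

(** * Uniform measures on finite families of points and their Gaussian convolutions *)

Section mean_dirac.
Context {R : realType} {n : nat}.
Context (x : nat -> 'rV[R]_n) (N : nat).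

Definition mean_dirac : set (borel_rV R n) -> \bar R :=
  mscale (N.+1%:R^-1)%:nng (msum (fun i => dirac (x i : borel_rV R n)) N.+1).

HB.instance Definition _ := Measure.on mean_dirac.

Lemma mean_diracE (A : set (borel_rV R n)) :
  mean_dirac A = ((N.+1%:R^-1)%:E * \sum_(i < N.+1) \d_(x i : borel_rV R n) A)%E.
Proof. by []. Qed.

Lemma mean_dirac_id (A : set (borel_rV R n)) : (forall i, A (x i)) -> mean_dirac A = 1%E.
Proof.
move=> Ax; rewrite mean_diracE.
under eq_bigr do rewrite diracE mem_set//.
by rewrite sumEFin sumr_const card_ord -EFinM mulVf.
Qed.

HB.instance Definition _ := Measure_isProbability.Build _ _ _ mean_dirac
  (@mean_dirac_id setT (fun=> I)).

End mean_dirac.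

Section gauss.
Context {R : realType} {n : nat}.
Implicit Types (x z : 'rV[R]_n) (N : nat) (s q : R).

Lemma gaussE s z :
  gauss s z = (2 * pi * s) `^ (- (n%:R / 2)) * expR (- (s^-1 / 2 * enorm z ^+ 2)).
Proof. by rewrite /gauss; congr (_ * expR _); rewrite invfM; ring. Qed.

Lemma gauss_ge0 s z : 0 <= gauss s z.
Proof. by rewrite mulr_ge0 ?powR_ge0 ?expR_ge0. Qed.

Lemma measurable_enorm_sub (x : 'rV[R]_n) :
  measurable_fun [set: borel_rV R n] (fun z : borel_rV R n => enorm (z - x)).
Proof.
apply: (measurableT_comp (@measurable_enorm R n)); apply: measurable_fun_rV => i.
rewrite (_ : (fun z => _) = (fun z : borel_rV R n => z ord0 i - x ord0 i)).
  by apply: measurable_funB => //; exact: measurable_coord_rV.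
by apply/funext => z; rewrite !mxE.
Qed.

Lemma measurable_expR_enorm_sub (a : R) (x : 'rV[R]_n) :
  measurable_fun [set: borel_rV R n]
    (fun z : borel_rV R n => expR (- (a * enorm (z - x) ^+ 2))).
Proof.
apply: (measurableT_comp (@measurable_expR R)); apply: measurable_funN.
apply: measurable_funM => //; apply: measurable_funX; exact: measurable_enorm_sub.
Qed.

Lemma gauss_conv_mean_dirac (x : nat -> 'rV[R]_n) N s z :
  gauss_conv (mean_dirac x N) s z =
  N.+1%:R^-1 * \sum_(i < N.+1) gauss s (z - x i).
Proof.
rewrite /gauss_conv.
have mg : measurable_fun [set: borel_rV R n]
    (fun y : borel_rV R n => (gauss s (z - y))%:E).
  apply/measurable_EFinP.
  under eq_fun => y do rewrite gaussE enormB.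
  by apply: measurable_funM => //; exact: measurable_expR_enorm_sub.
rewrite ge0_integral_mscale//; last by move=> y _; rewrite lee_fin gauss_ge0.
rewrite ge0_integral_measure_sum//; last by move=> y _; rewrite lee_fin gauss_ge0.
under eq_bigr do rewrite integral_dirac// diracT mul1e.
by rewrite sumEFin -EFinM.
Qed.

(** All atoms lie in [K], so restricting to [K] loses no mass and each atom [x i] moves to
    [T (x i)]. *)
Lemma pushforward_on_mean_dirac (K : set 'rV[R]_n) (T : 'rV[R]_n -> 'rV[R]_n)
    (x : nat -> 'rV[R]_n) N : (forall i, K (x i)) ->
  pushforward_on K T (mean_dirac x N) = mean_dirac (T \o x) N.
Proof.
move=> Kx; apply/funext => A.
rewrite mean_diracE /pushforward_on /pushforward mean_diracE; congr (_ * _)%E.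
apply: eq_bigr => i _; rewrite !diracE; congr (_%:E); congr (_%:R); congr nat_of_bool.
by apply/idP/idP; rewrite !inE /=; [case|move=> ?; split].
Qed.

End gauss.

(** * The energy densities used as test functions *)

Section truncation.
Context {R : realType}.
Implicit Types a b c t u : R.

Definition cutoff a b t : R := if t <= b then Num.min (t / a) 1 else 0.

Lemma cutoff_le1 a b t : cutoff a b t <= 1.
Proof. by rewrite /cutoff; case: ifP => // _; rewrite ge_min lexx orbT. Qed.

Lemma cutoff_ge0 a b t : 0 < a -> 0 <= t -> 0 <= cutoff a b t.
Proof.
move=> a0 t0; rewrite /cutoff; case: ifP => // _.
by rewrite le_min ler01 andbT divr_ge0// ltW.
Qed.

(** Rescaling both thresholds absorbs the normalizing constant of the Gaussian density. *)
Lemma cutoffM a b c t : 0 < c -> cutoff (c * a) (c * b) (c * t) = cutoff a b t.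
Proof.
by move=> c0; rewrite /cutoff ler_pM2l// -mulf_div divff ?gt_eqF// mul1r.
Qed.

Lemma measurable_cutoff a b : measurable_fun setT (cutoff a b).
Proof.
apply: measurable_fun_ifT => //.
- exact: measurable_fun_ler.
- by apply: measurable_minr => //; exact: measurable_funM.
Qed.

(** Divided by [t], the density is [- min (1 / a) (1 / t)] up to [b] and 0 beyond: nondecreasing on
    both ranges, with an upward jump at [b]. *)
Lemma cutoff_nonnegative_pressure a b : 0 < a -> 0 < b ->
  nonnegative_pressure (fun t => - cutoff a b t).
Proof.
move=> a0 b0; split; [split|].
- by apply/measurable_funTS/measurable_funN; exact: measurable_cutoff.
- by rewrite /cutoff ltW// mul0r min_l// oppr0.
move=> t u; rewrite !in_itv/= !andbT => t0 u0 tu.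
rewrite !mulNr lerN2 ler_pdivrMr// mulrAC ler_pdivlMr//.
rewrite {1}/cutoff; case: ifP => ub; last first.
  by rewrite mul0r mulr_ge0 ?cutoff_ge0 ?ltW.
rewrite /cutoff (le_trans tu ub).
have [ta|ta] := leP (t / a) 1.
  have -> : t / a * u = u / a * t by rewrite mulrC mulrA mulrAC.
  by rewrite ler_wpM2r ?(ltW t0)// ge_min lexx.
rewrite mul1r; apply: le_trans tu; rewrite -[leRHS]mul1r ler_wpM2r ?(ltW t0)//.
by rewrite ge_min lexx orbT.
Qed.

(** A minimum of two affine functions is concave. The drop of [cutoff] to 0 past [b] would destroy
    this, so the density here has no upper threshold. *)
Lemma cutoff_nondecreasing_pressure a : 0 < a ->
  nondecreasing_pressure (fun t => - Num.min (t / a) 1).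
Proof.
move=> a0; split; [split|].
- apply/measurable_funTS/measurable_funN.
  by apply: measurable_minr => //; exact: measurable_funM.
- by rewrite mul0r min_l// oppr0.
move=> t x y _ _.
pose w : R := t%:num; pose w' : R := 1 - t%:num.
have w0 : 0 <= w by rewrite /w; exact: ge0.
have w'0 : 0 <= w' by rewrite /w' subr_ge0.
have ww' : w + w' = 1 by rewrite /w' addrC subrK.
suff H (u v : R) : - Num.min ((w * u + w' * v) / a) 1 <=
    w * - Num.min (u / a) 1 + w' * - Num.min (v / a) 1 by exact: H.
rewrite !mulrN -opprD lerN2 le_min; apply/andP; split.
  by rewrite [leRHS]mulrDl -!mulrA; apply: lerD; rewrite ler_wpM2l// ge_min lexx.
rewrite -[leRHS]ww'; apply: lerD; rewrite -[leRHS]mulr1;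
  by rewrite ler_wpM2l// ge_min lexx orbT.
Qed.

End truncation.

Lemma internal_energyN (R : realType) n (rho : 'rV[R]_n -> R) (h : R -> R) :
  (forall x, 0 <= h (rho x)) ->
  internal_energy (fun t => - h t) rho = (- \int[lebesgue_rV n]_x (h (rho x))%:E)%E.
Proof.
move=> h0; rewrite /internal_energy -integral_ge0N//.
by move=> x _; rewrite lee_fin.
Qed.

Lemma internal_energyN_defined (R : realType) n (rho : 'rV[R]_n -> R) (h : R -> R) :
  measurable_fun [set: borel_rV R n] (rho : borel_rV R n -> R) ->
  measurable_fun setT h -> (forall x, 0 <= h (rho x)) ->
  internal_energy_defined (fun t => - h t) rho.
Proof.
move=> mrho mh h0; split.
  by apply/measurable_EFinP/measurable_funN; exact: measurableT_comp mh mrho.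
left; under eq_integral => x _.
  rewrite funeposE max_r ?lee_fin ?oppr_le0//.
  over.
by rewrite integral0 ltry.
Qed.

(** * The energy inequality for Gaussian mixtures over finitely many points *)

Section gaussian_mean.
Context {R : realType} {n : nat}.
Implicit Types (x y : nat -> 'rV[R]_n) (z : 'rV[R]_n) (N : nat) (a b q r : R).

(** The density of the uniform measure convolved with [gamma_s], for [q = 1 / s], without its
    normalizing constant. Small times become large [q]. *)
Definition gaussian_mean q x N z : R :=
  N.+1%:R^-1 * \sum_(i < N.+1) expR (- (q / 2 * enorm (z - x i) ^+ 2)).

Lemma gauss_conv_gaussian_mean q x N z :
  gauss_conv (mean_dirac x N) q^-1 z =
  (2 * pi * q^-1) `^ (- (n%:R / 2)) * gaussian_mean q x N z.
Proof.
rewrite gauss_conv_mean_dirac /gaussian_mean mulrCA; congr (_ * _).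
by rewrite mulr_sumr; apply: eq_bigr => i _; rewrite gaussE invrK.
Qed.

Lemma measurable_gaussian_mean q x N :
  measurable_fun [set: borel_rV R n] (gaussian_mean q x N).
Proof.
apply: measurable_funM => //; apply: measurable_sum => i.
exact: measurable_expR_enorm_sub.
Qed.

Lemma gaussian_mean_ge0 q x N z : 0 <= gaussian_mean q x N z.
Proof. by rewrite mulr_ge0 ?invr_ge0// sumr_ge0// => i _; exact: expR_ge0. Qed.

Lemma gaussian_mean_le q r x N z : 0 <= q -> 0 <= r ->
  (forall i, (i < N.+1)%N -> r <= enorm (z - x i)) ->
  gaussian_mean q x N z <= expR (- (q / 2 * r ^+ 2)).
Proof.
move=> q0 r0 rx; rewrite /gaussian_mean ler_pdivrMl// mulr_natl.
apply: (@le_trans _ _ (\sum_(i < N.+1) expR (- (q / 2 * r ^+ 2)))); last first.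
  by rewrite sumr_const card_ord.
apply: ler_sum => i _.
rewrite ler_expR lerN2 ler_wpM2l ?divr_ge0// ler_sqr ?nnegrE ?enorm_ge0//.
exact: rx.
Qed.

Lemma gaussian_mean_ge q x N z i : (i < N.+1)%N ->
  N.+1%:R^-1 * expR (- (q / 2 * enorm (z - x i) ^+ 2)) <= gaussian_mean q x N z.
Proof.
move=> iN; rewrite ler_wpM2l ?invr_ge0// (bigD1 (Ordinal iN))//= lerDl.
by rewrite sumr_ge0// => j _; exact: expR_ge0.
Qed.

Lemma gaussian_mean_le1 q x N z : 0 <= q -> gaussian_mean q x N z <= 1.
Proof.
move=> q0; have := @gaussian_mean_le q 0 x N z q0 (lexx _) (fun i _ => enorm_ge0 _).
by rewrite expr0n/= mulr0 oppr0 expR0.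
Qed.

Let c q : R := (2 * pi * q^-1) `^ (- (n%:R / 2)).

Let c_gt0 q : 0 < q -> 0 < c q.
Proof. by move=> q0; rewrite powR_gt0// !mulr_gt0 ?pi_gt0 ?invr_gt0. Qed.

Let rhoE q x N : gauss_conv (mean_dirac x N) q^-1 = (fun z => c q * gaussian_mean q x N z).
Proof. by apply/funext => z; exact: gauss_conv_gaussian_mean. Qed.

Let mrho q x N : measurable_fun [set: borel_rV R n]
  (fun z : borel_rV R n => c q * gaussian_mean q x N z).
Proof. by apply: measurable_funM => //; exact: measurable_gaussian_mean. Qed.

(** The hypothesis is applied to the uniform measure on the points, at time [q^-1], with minus
    [cutoff] at thresholds multiplied by [c q]. The sign reverses the inequality, so the side of [T]
    becomes the smaller one. *)
Lemma energies_le_nonnegative_cutoff (K : set 'rV[R]_n) (T : 'rV[R]_n -> 'rV[R]_n)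
    x N a b q :
  energies_le (@nonnegative_pressure R) K T ->
  (forall i, K (x i)) -> 0 < q -> 0 < a -> 0 < b ->
  (\int[lebesgue_rV n]_z (cutoff a b (gaussian_mean q (T \o x) N z))%:E <=
   \int[lebesgue_rV n]_z (cutoff a b (gaussian_mean q x N z))%:E)%E.
Proof.
move=> HK Kx q0 a0 b0.
have h0 y z : 0 <= cutoff (c q * a) (c q * b) (c q * gaussian_mean q y N z).
  by rewrite cutoff_ge0 ?mulr_gt0 ?c_gt0// mulr_ge0 ?gaussian_mean_ge0// ltW// c_gt0.
have E y : internal_energy (fun t => - cutoff (c q * a) (c q * b) t)
    (fun z => c q * gaussian_mean q y N z) =
    (- \int[lebesgue_rV n]_z (cutoff a b (gaussian_mean q y N z))%:E)%E.
  rewrite (internal_energyN (h0 y)); congr (- _)%E.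
  by apply: eq_integral => z _; rewrite cutoffM// c_gt0.
have := HK (mean_dirac x N) (mean_dirac_id _ Kx) q^-1.
rewrite invr_gt0 => /(_ q0 (fun t => - cutoff (c q * a) (c q * b) t)).
move=> /(_ (cutoff_nonnegative_pressure
  (mulr_gt0 (c_gt0 q0) a0) (mulr_gt0 (c_gt0 q0) b0))).
cbv zeta; rewrite (pushforward_on_mean_dirac T N Kx).
rewrite (rhoE q x N) (rhoE q (T \o x) N).
have mt := @measurable_cutoff R (c q * a) (c q * b).
move=> /(_ (internal_energyN_defined (@mrho _ _ _) mt (h0 _))).
move=> /(_ (internal_energyN_defined (@mrho _ _ _) mt (h0 _))).
by rewrite !E leeN2.
Qed.

(** A [gaussian_mean] never exceeds 1, so for [1 <= b] the upper threshold is never passed and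
    [cutoff] coincides with the concave profile. *)
Lemma energies_le_nondecreasing_cutoff (K : set 'rV[R]_n) (T : 'rV[R]_n -> 'rV[R]_n)
    x N a b q :
  energies_le (@nondecreasing_pressure R) K T ->
  (forall i, K (x i)) -> 0 < q -> 0 < a -> 1 <= b ->
  (\int[lebesgue_rV n]_z (cutoff a b (gaussian_mean q (T \o x) N z))%:E <=
   \int[lebesgue_rV n]_z (cutoff a b (gaussian_mean q x N z))%:E)%E.
Proof.
move=> HK Kx q0 a0 b1.
pose h t := Num.min (t / (c q * a)) 1.
have hE y z : h (c q * gaussian_mean q y N z) = cutoff a b (gaussian_mean q y N z).
  rewrite /cutoff (le_trans _ b1) ?gaussian_mean_le1 ?ltW// /h.
  by rewrite -mulf_div divff ?gt_eqF ?c_gt0// mul1r.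
have h0 y z : 0 <= h (c q * gaussian_mean q y N z).
  by rewrite hE cutoff_ge0 ?gaussian_mean_ge0.
have mh : measurable_fun setT h.
  by apply: measurable_minr => //; exact: measurable_funM.
have E y : internal_energy (fun t => - h t)
    (fun z => c q * gaussian_mean q y N z) =
    (- \int[lebesgue_rV n]_z (cutoff a b (gaussian_mean q y N z))%:E)%E.
  rewrite (internal_energyN (h0 y)); congr (- _)%E.
  by apply: eq_integral => z _; rewrite hE.
have := HK (mean_dirac x N) (mean_dirac_id _ Kx) q^-1.
rewrite invr_gt0 => /(_ q0 (fun t => - h t)).
move=> /(_ (cutoff_nondecreasing_pressure (mulr_gt0 (c_gt0 q0) a0))).
cbv zeta; rewrite (pushforward_on_mean_dirac T N Kx).
rewrite (rhoE q x N) (rhoE q (T \o x) N).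
move=> /(_ (internal_energyN_defined (@mrho _ _ _) mh (h0 _))).
move=> /(_ (internal_energyN_defined (@mrho _ _ _) mh (h0 _))).
by rewrite !E leeN2.
Qed.

(** For [r1 <= 0] the first condition holds everywhere and the shell is the whole [r2]-neighbourhood
    of the points. *)
Definition shell x N r1 r2 : set 'rV[R]_n :=
  [set z | (forall i, (i < N.+1)%N -> r1 <= enorm (z - x i)) /\
           exists2 i, (i < N.+1)%N & enorm (z - x i) <= r2].

Lemma measurable_shell x N r1 r2 :
  measurable (shell x N r1 r2 : set (borel_rV R n)).
Proof.
have mx i := measurable_enorm_sub (x i).
rewrite (_ : shell x N r1 r2 =
  (\bigcap_(i in `I_N.+1) ((fun z => enorm (z - x i)) @^-1` `[r1, +oo[%classic)) `&`
  (\bigcup_(i in `I_N.+1) ((fun z => enorm (z - x i)) @^-1` `]-oo, r2]%classic)));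
  last first.
  apply/seteqP; split=> z [z1 [i iN zi]]; (split; last by exists i => //=;
    move: zi; rewrite /= in_itv).
  - by move=> j jN /=; rewrite in_itv/= z1.
  - by move=> j jN; have := z1 _ jN; rewrite /= in_itv/= andbT.
apply: measurableI.
  apply: fin_bigcap_measurable => // i _.
  by rewrite -[X in measurable X]setTI; exact: mx.
apply: fin_bigcup_measurable => // i _.
by rewrite -[X in measurable X]setTI; exact: mx.
Qed.

End gaussian_mean.

(** * Laplace asymptotics: cutoff integrals approximate shell volumes *)

Section laplace.
Context {R : realType} {n : nat}.
Implicit Types (x y : nat -> 'rV[R]_n) (z : 'rV[R]_n) (N : nat) (a b q r : R).

(* If some x i is at distance at most r from z, the mean of the Gaussians is at
   least [cut_low] at z; if all are at distance at least r, it is at most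
   [cut_high]. *)
Definition cut_low N q r : R := N.+1%:R^-1 * expR (- (q / 2 * r ^+ 2)).
Definition cut_high q r : R := expR (- (q / 2 * r ^+ 2)).

Lemma cut_low_gt0 N q r : 0 < cut_low N q r.
Proof. by rewrite mulr_gt0 ?invr_gt0 ?expR_gt0. Qed.

Lemma measurable_cutoff_gaussian_mean a b q x N :
  measurable_fun [set: borel_rV R n]
    (fun z : borel_rV R n => (cutoff a b (gaussian_mean q x N z))%:E).
Proof.
apply/measurable_EFinP.
exact: measurableT_comp (@measurable_cutoff R a b) (measurable_gaussian_mean q x N).
Qed.

(** On the shell the mean lies between the two thresholds, so [cutoff] equals 1 there. This bound
    holds for every positive [q]. *)
Lemma shell_le_cutoff x N q r1 r2 : 0 < q -> 0 <= r1 -> 0 <= r2 ->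
  (lebesgue_rV n (shell x N r1 r2) <=
   \int[lebesgue_rV n]_z
      (cutoff (cut_low N q r2) (cut_high q r1) (gaussian_mean q x N z))%:E)%E.
Proof.
move=> q0 r10 r20.
have mS := measurable_shell x N r1 r2.
rewrite -(setIT (shell x N r1 r2)) -integral_indic//.
apply: ge0_le_integral => //.
- by apply/measurable_EFinP; exact: measurable_indic.
- exact: measurable_cutoff_gaussian_mean.
move=> z _; rewrite lee_fin indicE.
have [|_] := boolP (z \in shell x N r1 r2); last first.
  by rewrite cutoff_ge0 ?cut_low_gt0// gaussian_mean_ge0.
rewrite inE => -[z1 [i iN zi]].
rewrite /cutoff gaussian_mean_le ?(ltW q0)// le_min lexx andbT.
rewrite ler_pdivlMr ?cut_low_gt0// mul1r.
apply: le_trans (gaussian_mean_ge _ _ _ iN); rewrite ler_wpM2l ?invr_ge0//.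
by rewrite ler_expR lerN2 ler_wpM2l ?divr_ge0 ?(ltW q0)// ler_sqr ?nnegrE ?enorm_ge0.
Qed.

(** The factor, independent of [q] and [z], left when the Gaussians centred at the points are
    compared with [expR (- enorm z ^+ 2)]. *)
Definition gauss_tail N x r : R :=
  \sum_(i < N.+1) expR (2 * r ^+ 2 + 2 * enorm (x i) ^+ 2).

(** Too near the points the mean passes [cut_high] and [cutoff] vanishes; on the enlarged shell
    [cutoff] is at most 1; farther out it is at most the mean over [cut_low], an integrable tail
    with a factor exponentially small in [q]. *)
Lemma cutoff_le_shell x N q r1 r2 e z : 0 < e -> 0 <= r1 -> 0 <= r2 ->
  4 <= q -> N.+1%:R <= e ^+ 2 * q / 2 ->
  cutoff (cut_low N q r2) (cut_high q r1) (gaussian_mean q x N z) <=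
  \1_(shell x N (r1 - e) (r2 + e)) z +
  expR (- (e ^+ 2 / 2 * (q - 4))) * gauss_tail N x r2 * expR (- enorm z ^+ 2).
Proof.
move=> e0 r10 r20 q4 Nq.
have q0 : 0 < q by apply: lt_le_trans q4.
have tail_ge0 :
    0 <= expR (- (e ^+ 2 / 2 * (q - 4))) * gauss_tail N x r2 *
      expR (- enorm z ^+ 2).
  by rewrite !mulr_ge0 ?expR_ge0// sumr_ge0// => i _; exact: expR_ge0.
have [gb|gb] := leP (gaussian_mean q x N z) (cut_high q r1); last first.
  by rewrite /cutoff (lt_geF gb) addr_ge0.
have zlow i : (i < N.+1)%N -> r1 - e <= enorm (z - x i).
  (* A point closer than [r1 - e] contributes a Gaussian at least [expR (e ^+ 2 * q / 2)] times
     [cut_high]. This factor exceeds [N.+1], so even after averaging the mean would be above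
     [cut_high]. *)
  move=> iN; rewrite leNgt; apply/negP => zi.
  set d := enorm (z - x i) in zi.
  have d0 : 0 <= d := enorm_ge0 _.
  have dr : d ^+ 2 + e ^+ 2 <= r1 ^+ 2 by nra.
  have := le_trans (gaussian_mean_ge q x z iN) gb.
  rewrite -/d ler_pdivrMl//.
  have : cut_high q r1 <= expR (- (q / 2 * d ^+ 2)) * expR (- (e ^+ 2 * q / 2)).
    rewrite -expRD ler_expR; nra.
  have E0 := expR_gt0 (- (q / 2 * d ^+ 2)).
  have := expR_ge1Dx (e ^+ 2 * q / 2).
  rewrite [expR (- (e ^+ 2 * q / 2))]expRN; set E := expR (e ^+ 2 * q / 2) => E1 E2 E3.
  have Egt0 : 0 < E := expR_gt0 _.
  have : N.+1%:R * cut_high q r1 <= N.+1%:R * (expR (- (q / 2 * d ^+ 2)) * E^-1).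
    by rewrite ler_wpM2l.
  move/(le_trans E3); rewrite [leRHS]mulrCA -[leLHS]mulr1.
  rewrite ler_pM2l// ler_pdivlMr// mul1r => EN.
  lra.
have [zS|zS] := boolP (z \in shell x N (r1 - e) (r2 + e)).
  by rewrite indicE zS (le_trans (cutoff_le1 _ _ _))// lerDl.
rewrite indicE (negbTE zS) add0r.
have zhigh i : (i < N.+1)%N -> r2 + e <= enorm (z - x i).
  move=> iN; rewrite leNgt; apply/negP => zi; move/negP : zS; apply.
  by rewrite inE; split=> //; exists i => //; exact: ltW.
rewrite /cutoff gb ge_min; apply/orP; left.
rewrite ler_pdivrMr ?cut_low_gt0// [leRHS]mulrC /gaussian_mean /cut_low.
rewrite -[leRHS]mulrA ler_wpM2l ?invr_ge0//.
rewrite [expR _ * gauss_tail _ _ _]mulrC /gauss_tail !mulr_suml mulr_sumr.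
apply: ler_sum => i _.
rewrite -!expRD ler_expR.
have := zhigh i (ltn_ord i); have := enorm_half_sqr z (x i).
set d := enorm (z - x i); have d0 : 0 <= d := enorm_ge0 _.
move=> zd rd.
have h0 : e ^+ 2 <= d ^+ 2 - r2 ^+ 2 by nra.
(* The rate [q / 2] splits as [2 + (q - 4) / 2]: the first part yields [expR (- enorm z ^+ 2)]
   through [enorm_half_sqr], the second the small factor. *)
have : 0 <= (d ^+ 2 - r2 ^+ 2 - e ^+ 2) * (q - 4) by rewrite mulr_ge0 ?subr_ge0.
lra.
Qed.

(** Integrating the pointwise bound leaves the shell volume plus a tail that is at most [e] once [q]
    is large. *)
Lemma cutoff_le_shellD x N r1 r2 e : 0 < e -> 0 <= r1 -> 0 <= r2 ->
  exists2 q, 0 < q &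
   (\int[lebesgue_rV n]_z
      (cutoff (cut_low N q r2) (cut_high q r1) (gaussian_mean q x N z))%:E <=
    lebesgue_rV n (shell x N (r1 - e) (r2 + e)) + e%:E)%E.
Proof.
move=> e0 r10 r20; have [I I0 IE] := gauss_integral_rV R n.
have C0 : 0 <= gauss_tail N x r2 by apply: sumr_ge0 => i _; exact: expR_ge0.
set C := gauss_tail N x r2 in C0.
have e2 : 0 < e ^+ 2 by rewrite exprn_gt0.
have CI0 : 0 <= C * I by rewrite mulr_ge0.
(* [q1] ensures [N.+1%:R <= e ^+ 2 * q / 2]. [q2] brings the integral of the tail below [e], using
   only [1 + t <= expR t]. *)
pose q1 : R := 2 * N.+1%:R / e ^+ 2; pose q2 : R := 2 * (C * I) / e / e ^+ 2.
have q10 : 0 <= q1 by rewrite divr_ge0// ?mulr_ge0// ltW.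
have q20 : 0 <= q2 by rewrite !divr_ge0// ?mulr_ge0// ltW.
have q1E : e ^+ 2 * q1 = 2 * N.+1%:R by rewrite mulrC divfK ?gt_eqF.
have q2E : e ^+ 2 * q2 = 2 * (C * I) / e by rewrite mulrC divfK ?gt_eqF.
pose q := 4 + q1 + q2; have q0 : 0 < q by rewrite /q; lra.
exists q => //.
pose eps := expR (- (e ^+ 2 / 2 * (q - 4))).
have eps0 : 0 <= eps := expR_ge0 _.
have epsCI : eps * C * I <= e.
  rewrite /eps expRN -mulrA ler_pdivrMl ?expR_gt0//.
  apply: (@le_trans _ _ ((1 + e ^+ 2 / 2 * (q - 4)) * e)); last first.
    by rewrite ler_wpM2r ?(ltW e0)// expR_ge1Dx.
  have -> : e ^+ 2 / 2 * (q - 4) = N.+1%:R + C * I / e.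
    have -> : e ^+ 2 / 2 * (q - 4) = (e ^+ 2 * q1 + e ^+ 2 * q2) / 2.
      by rewrite /q; field.
    by rewrite q1E q2E; field; rewrite gt_eqF.
  rewrite !mulrDl divfK ?gt_eqF// mul1r addrA lerDr.
  by rewrite addr_ge0 ?mulr_ge0// ltW.
have mS := measurable_shell x N (r1 - e) (r2 + e).
have mg := @measurable_expR_enorm R n.
have mi : measurable_fun [set: borel_rV R n]
    (fun z : borel_rV R n => (\1_(shell x N (r1 - e) (r2 + e)) z)%:E : \bar R).
  by apply/measurable_EFinP; exact: measurable_indic.
apply: (@le_trans _ _ (\int[lebesgue_rV n]_z
   ((\1_(shell x N (r1 - e) (r2 + e)) z)%:E +
    (eps * C)%:E * (expR (- enorm z ^+ 2))%:E))%E).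
  apply: ge0_le_integral => //.
  - by move=> z _; rewrite lee_fin cutoff_ge0 ?cut_low_gt0// gaussian_mean_ge0.
  - exact: measurable_cutoff_gaussian_mean.
  - by apply: emeasurable_funD => //; exact: measurable_funeM.
  move=> z _; rewrite -EFinM -EFinD lee_fin; apply: cutoff_le_shell => //.
    by rewrite /q; lra.
  have : 0 <= e ^+ 2 * q2 by rewrite mulr_ge0// ltW.
  by rewrite /q; nra.
rewrite ge0_integralD//; last 2 first.
- by move=> z _; rewrite -EFinM lee_fin !mulr_ge0// expR_ge0.
- exact: measurable_funeM.
rewrite integral_indic// setIT leeD2l// ge0_integralZl//.
  by rewrite IE -EFinM lee_fin.
by rewrite lee_fin mulr_ge0.
Qed.

End laplace.

(** * From nets to the compact sets, and the limit of vanishing mesh *)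

Section limit.
Context {R : realType} {n : nat}.
Context (K : set 'rV[R]_n) (T : 'rV[R]_n -> 'rV[R]_n) (K_compact : compact K)
  (T_lipschitz :
     forall x y, K x -> K y -> enorm (T x - T y) <= enorm (x - y)).

Let TK_compact : compact (T @` K) := compact_image_lipschitz K_compact T_lipschitz.

(** The form in which both pressure hypotheses enter: nonnegative pressure yields it for all radii,
    nondecreasing pressure for [r1 = 0], where [cut_high] is 1. *)
Definition cutoff_integral_le r1 r2 : Prop :=
  forall (x : nat -> 'rV[R]_n) N q, (forall i, K (x i)) -> 0 < q ->
  (\int[lebesgue_rV n]_z
     (cutoff (cut_low N q r2) (cut_high q r1) (gaussian_mean q (T \o x) N z))%:E <=
   \int[lebesgue_rV n]_z
     (cutoff (cut_low N q r2) (cut_high q r1) (gaussian_mean q x N z))%:E)%E.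

Lemma near_setD_leD r1 r2 e : 0 < e -> 0 <= r2 ->
  cutoff_integral_le (Num.max 0 (r1 + 3 * e)) (r2 + e) ->
  (lebesgue_rV n (near_set (T @` K) r2 `\` near_set (T @` K) (r1 + 3 * e)) <=
   lebesgue_rV n (near_set K (r2 + 2 * e) `\` near_set K r1) + e%:E)%E.
Proof.
move=> e0 r20 H.
have [K0|K0] := pselect (K !=set0); last first.
  rewrite (_ : near_set (T @` K) r2 = set0); last first.
    by apply/seteqP; split=> // z [_ [p Kp _] _]; apply: K0; exists p.
  by rewrite set0D measure0 adde_ge0// lee_fin ltW.
have [N [x [Kx xK]]] := compact_net K_compact K0 e0.
(* The inner radius is clamped at 0 because the thresholds only see its square. The outer radius
   grows by [e] for passing to the net, and by another [e] in the Laplace bound. *)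
set r1' := Num.max 0 _ in H; pose r2' := r2 + e.
have r1'0 : 0 <= r1' by rewrite le_max lexx.
have r1'e : r1 + 3 * e <= r1' by rewrite le_max lexx orbT.
have r2'0 : 0 <= r2' by rewrite addr_ge0// ltW.
have [q q0 Hq] := cutoff_le_shellD x N e0 r1'0 r2'0.
have mD A s t : compact A ->
    measurable (near_set A s `\` near_set A t : set (borel_rV R n)).
  by move=> cA; apply: measurableD; exact: measurable_near_set.
apply: (@le_trans _ _ (lebesgue_rV n (shell (T \o x) N r1' r2'))).
  apply: le_measure; rewrite ?inE; [exact: mD|exact: measurable_shell|].
  move=> z [[_ [p Kp <-] zp] zr1]; split=> [i iN|].
    rewrite ge_max enorm_ge0/= leNgt; apply/negP => zi; apply: zr1.
    by exists (T (x i)); [exists (x i)|exact: ltW].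
  have [i iN pi] := xK p Kp; exists i => //=.
  have := T_lipschitz Kp (Kx i); have := ler_enormBD z (T p) (T (x i)).
  by rewrite /r2'; lra.
apply: le_trans (shell_le_cutoff _ _ q0 r1'0 r2'0) _.
apply: le_trans (H _ _ _ Kx q0) _; apply: (le_trans Hq); rewrite leeD2r//.
apply: le_measure; rewrite ?inE; [exact: measurable_shell|exact: mD|].
move=> z [z1 [i iN zi]]; split.
  by exists (x i) => //; move: zi; rewrite /r2'; lra.
(* The shell stays at distance at least [r1 + 2 * e] from the net, while a point within [r1] of [K]
   is within [r1 + e] of it. The third [e] in [r1 + 3 * e] makes the contradiction strict. *)
move=> [p Kp zp]; have [j jN pj] := xK p Kp.
have := z1 j jN; have := ler_enormBD z p (x j); lra.
Qed.

Lemma near_setD_le r1 r2 : 0 <= r2 ->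
  (forall r, Num.max 0 r1 <= r -> r <= Num.max 0 (r1 + 1) ->
   forall r', 0 < r' -> cutoff_integral_le r r') ->
  (lebesgue_rV n (near_set (T @` K) r2 `\` near_set (T @` K) r1) <=
   lebesgue_rV n (near_set K r2 `\` near_set K r1))%E.
Proof.
move=> r20 H.
(* Since [3 * e k = k.+1%:R^-1 <= 1], the clamped inner radii stay in the range covered by [H]. *)
pose e k : R := k.+1%:R^-1 / 3.
have e0 k : 0 < e k by rewrite divr_gt0.
have e3 k : 3 * e k = k.+1%:R^-1 by rewrite mulrC divfK.
have e_le i j : (i <= j)%N -> e j <= e i.
  by move=> ij; rewrite ler_pM2r// lef_pV2 ?posrE// ler_nat ltnS.
pose F k : set (borel_rV R n) :=
  near_set (T @` K) r2 `\` near_set (T @` K) (r1 + 3 * e k).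
pose G k : set (borel_rV R n) := near_set K (r2 + 2 * e k) `\` near_set K r1.
have e_small d : 0 < d -> exists k, 3 * e k < d.
  move=> d0; exists (Num.truncn d^-1); rewrite e3 invf_plt ?posrE//.
  exact: truncnS_gt.
have FE : near_set (T @` K) r2 `\` near_set (T @` K) r1 = \bigcup_k F k.
  apply/seteqP; split=> [z [z2 z1]|z [k _ [z2 z1]]]; last first.
    by split=> // z1'; apply: z1; apply: near_set_le z1'; rewrite lerDl e3.
  have [d d0 zd] := compact_near_set TK_compact z1.
  have [k kd] := e_small d d0; exists k => //; split=> // zk; apply: zd.
  by apply: near_set_le zk; rewrite lerD2l ltW.
have GE : near_set K r2 `\` near_set K r1 = \bigcap_k G k.
  apply/seteqP; split=> [z [z2 z1] k _|z zG]; last first.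
    split; last by have [] := zG 0%N I.
    apply: contrapT => /(compact_near_set K_compact)[d d0]; apply.
    have [k kd] := e_small d d0; have [+ _] := zG k I; apply: near_set_le.
    by rewrite lerD2l; have := e0 k; lra.
  by split=> //; apply: near_set_le z2; rewrite lerDl mulr_ge0// ltW.
have mF k : measurable (F k) by apply: measurableD; exact: measurable_near_set.
have mG k : measurable (G k) by apply: measurableD; exact: measurable_near_set.
have cF : lebesgue_rV n \o F @ \oo --> lebesgue_rV n (\bigcup_k F k).
  apply: nondecreasing_cvg_mu => //; first exact: bigcup_measurable.
  move=> i j ij; apply/subsetPset => z [z2 z1]; split=> // z1'; apply: z1.
  by apply: near_set_le z1'; rewrite lerD2l ler_pM2l// e_le.
have cG : lebesgue_rV n \o G @ \oo --> lebesgue_rV n (\bigcap_k G k).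
  apply: nonincreasing_cvg_mu => //; last 2 first.
  - exact: bigcap_measurable.
  - move=> i j ij; apply/subsetPset => z [z2 z1]; split=> //.
    by apply: near_set_le z2; rewrite lerD2l ler_pM2l// e_le.
  have [M KM] := compact_enorm_bounded K_compact.
  apply: (@lebesgue_bounded_fin _ _ _ (r2 + 2 * e 0%N + M)) => // z [[p Kp zp] _].
  have := KM p Kp; have := ler_enormD (z - p) p; rewrite subrK; lra.
have ce : (e k)%:E @[k --> \oo] --> 0%:E.
  apply: cvg_EFin; first by near=> k.
  rewrite -[0](mul0r 3^-1); apply: cvgMl; exact: cvg_harmonic.
have cGe : (lebesgue_rV n (G k) + (e k)%:E)%E @[k --> \oo] -->
    (lebesgue_rV n (\bigcap_k G k) + 0%:E)%E.
  by apply: cvgeD => //; exact: fin_num_adde_defl.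
rewrite FE GE -[leRHS]adde0 -(cvg_lim _ cF)// -(cvg_lim _ cGe)//.
apply: lee_lim; [by apply/cvg_ex; eexists; exact: cF|by apply/cvg_ex; eexists; exact: cGe|].
apply: nearW => k; apply: (near_setD_leD (e0 k) r20).
apply: H; last by rewrite ltr_wpDl.
  by rewrite le_max2// ?lerDl ?e3.
by rewrite le_max2// lerD2l e3 invf_le1// ler1n.
Unshelve. all: by end_near. Qed.

End limit.

Unset Implicit Arguments.
Set Strict Implicit.

Theorem theorem1p8 (R : realType) (n : nat) (K : set 'rV[R]_n)
    (T : 'rV[R]_n -> 'rV[R]_n)
    (K_compact : compact K)
    (T_lipschitz : forall x y : 'rV[R]_n,
      K x -> K y -> enorm (T x - T y) <= enorm (x - y)) :
  (energies_le (@nondecreasing_pressure R) K T ->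
    forall r : R, 0 < r ->
      (lebesgue_rV n (thicken (T @` K) r) <= lebesgue_rV n (thicken K r))%E)
  /\
  (energies_le (@nonnegative_pressure R) K T ->
    forall r1 r2 : R, 0 < r1 -> r1 < r2 ->
      (lebesgue_rV n (thicken (T @` K) r2 `\` thicken (T @` K) r1)
         <= lebesgue_rV n (thicken K r2 `\` thicken K r1))%E).
Proof.
split=> [HK r r0|HK r1 r2 r10 r12].
  rewrite !thickenE//.
  (* With [r1 = -1] the inner neighbourhoods are empty, and the range of inner radii, from
     [max 0 (-1)] to [max 0 (-1 + 1)], reduces to 0. There [cut_high] equals 1 and the convex
     density suffices. *)
  have := @near_setD_le R n K T K_compact T_lipschitz (-1) r (ltW r0).
  rewrite !(@near_set_lt0 _ _ _ (-1)) ?oppr_lt0// !setD0; apply.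
  move=> s; rewrite addNr maxxx ge_max => /andP[s0 _] s_le0 r' _ x N q Kx q0.
  have s1 : 1 <= cut_high q s.
    have -> : s = 0 by apply/le_anti; rewrite s_le0.
    by rewrite /cut_high expr0n mulr0 oppr0 expR0.
  exact: (@energies_le_nondecreasing_cutoff _ _ _ _ x N (cut_low N q r') _ _ HK Kx
    q0 (cut_low_gt0 _ _ _) s1).
have r20 := lt_trans r10 r12.
rewrite !thickenE//.
apply: (near_setD_le K_compact T_lipschitz (ltW r20)).
move=> s _ _ r' _ x N q Kx q0.
exact: (@energies_le_nonnegative_cutoff _ _ _ _ x N (cut_low N q r')
  (cut_high q s) _ HK Kx q0 (cut_low_gt0 _ _ _) (expR_gt0 _)).
Qed.
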